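(* Let $A, B, C \in \widehat{\mathbb{F}_q^{\times}}$ be such that $B \neq \varepsilon$, $A\neq B$, $B\neq C$ and $C\neq A$. For $x, y\in \mathbb{F}_q^{\times}$ such that $x,y\neq 1$ we have $$F_{4}\left(A;B;C,B;\frac{-x}{(1-x)(1-y)},\frac{-y}{(1-x)(1-y)}\right)^{*}$$ $$=A\left((1-x)(1-y)\right) F_{1}(A;\overline{B}C,A\overline{C};C;x,xy)^{*}-\frac{g(B)g(A\overline{B})}{q\, g(A)}\,\overline{B}(y)\,B\left((1-x)(1-y)\right).$$
   Context: Let $p$ be an odd prime, $q=p^r$ with $r\ge 1$, and $\mathbb{F}_q$ the field with $q$ elements. $\widehat{\mathbb{F}_q^{\times}}$ is the group of multiplicative characters $\mathbb{F}_q^\times\to\mathbb{C}^\times$; every $\chi\in\widehat{\mathbb{F}_q^{\times}}$, including the trivial character $\varepsilon$, is extended to $\mathbb{F}_q$ by $\chi(0)=0$. $\overline{\chi}$ denotes the inverse character of $\chi$, and juxtaposition denotes the product of characters; a bar over a product means the inverse of the product. Gauss sums: fix a primitive $p$-th root of unity $\zeta_p\in\mathbb{C}$, let $\theta(\alpha)=\zeta_p^{\mathrm{tr}(\alpha)}$ with $\mathrm{tr}:\mathbb{F}_q\to\mathbb{F}_p$ the trace, and set $g(\chi)=\sum_{t\in\mathbb{F}_q}\chi(t)\theta(t)$. For characters $A,B,B',C,C'$ and $x,y\in\mathbb{F}_q$, $$F_{1}(A;B,B';C;x,y)^{*}=\frac{1}{(q-1)^2}\sum_{\psi,\chi\in\widehat{\mathbb{F}_q^{\times}}}\frac{g(A\chi\psi)g(B\psi)g(B'\chi)g(\overline{C\chi\psi})g(\overline{\psi})g(\overline{\chi})}{g(A)g(B)g(B')g(\overline{C})}\psi(x)\chi(y),$$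 $$F_{4}(A;B;C,C';x,y)^{*}=\frac{1}{(q-1)^2}\sum_{\psi,\chi\in\widehat{\mathbb{F}_q^{\times}}}\frac{g(A\chi\psi)g(B\chi\psi)g(\overline{C\psi})g(\overline{C'\chi})g(\overline{\psi})g(\overline{\chi})}{g(A)g(B)g(\overline{C})g(\overline{C'})}\psi(x)\chi(y).$$ *)

(* Defs.v *)
From HB Require Import structures.
From mathcomp Require Import all_boot all_order all_algebra all_fingroup.
From mathcomp Require Import all_solvable all_field.
From mathcomp Require Import reals complex.

Set Implicit Arguments.
Unset Strict Implicit.
Unset Printing Implicit Defensive.

Import GRing.Theory FinRing.Theory.
Local Open Scope ring_scope.

Section MulChar.
Variables (F : finFieldType) (C : closedFieldType).

Definition is_mulchar (f : {ffun {unit F} -> C}) : bool :=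
  [forall u, f u != 0] && [forall u, forall v, f (u * v)%g == f u * f v].

Record mulchar := MulChar { mulchar_val : {ffun {unit F} -> C};
                            _ : is_mulchar mulchar_val }.

HB.instance Definition _ := [isSub for mulchar_val].
HB.instance Definition _ := [Choice of mulchar by <:].

Lemma mulchar_neq0 (chi : mulchar) u : mulchar_val chi u != 0.
Proof. by have /andP[/forallP] := valP chi. Qed.

Lemma mulcharM (chi : mulchar) u v : mulchar_val chi (u * v)%g =
  mulchar_val chi u * mulchar_val chi v.
Proof. by have /andP[_ /forallP/(_ u)/forallP/(_ v)/eqP] := valP chi. Qed.

Lemma mulchar1 (chi : mulchar) : mulchar_val chi 1%g = 1.
Proof.
apply: (mulfI (mulchar_neq0 chi 1%g)); by rewrite -mulcharM mulg1 mulr1.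
Qed.

(* Finiteness: all values are roots of 'X^#|{unit F}| - 1. *)
Definition mulchar_values : seq C :=
  sval (closed_field_poly_normal ('X^#|[set: {unit F}]| - 1 : {poly C})).

Lemma mulchar_valuesP (chi : mulchar) u : mulchar_val chi u \in mulchar_values.
Proof.
rewrite /mulchar_values; case: closed_field_poly_normal => /= s Es.
have n_gt0 : (0 < #|[set: {unit F}]|)%N by apply: cardG_gt0.
rewrite -root_prod_XsubC.
move: Es; rewrite lead_coefXnsubC // scale1r => <-.
rewrite /root !hornerE subr_eq0; apply/eqP.
have chiX n : mulchar_val chi (u ^+ n)%g = mulchar_val chi u ^+ n.
  by elim: n => [|n IHn]; rewrite ?mulchar1 // expgS mulcharM IHn exprS.
have uX1 : (u ^+ #|[set: {unit F}]|)%g == 1%g by rewrite -order_dvdn order_dvdG ?inE.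
by rewrite -chiX (eqP uX1) mulchar1.
Qed.

Definition mulchar_code (chi : mulchar) :
  {ffun {unit F} -> seq_sub mulchar_values} :=
  [ffun u => SeqSub (mulchar_valuesP chi u)].

Definition mulchar_decode (h : {ffun {unit F} -> seq_sub mulchar_values}) :
  option mulchar := insub [ffun u => val (h u)].

Lemma mulchar_codeK : pcancel mulchar_code mulchar_decode.
Proof.
move=> chi; rewrite /mulchar_decode.
have -> : [ffun u => val (mulchar_code chi u)] = val chi.
  by apply/ffunP => u; rewrite !ffunE.
exact: valK.
Qed.

HB.instance Definition _ := PCanIsCountable mulchar_codeK.
HB.instance Definition _ : isFinite mulchar := PCanIsFinite mulchar_codeK.

Lemma mulchar_one_subproof : is_mulchar [ffun=> 1].
Proof.
apply/andP; split; apply/forallP => u; first by rewrite ffunE oner_neq0.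
by apply/forallP => v; rewrite !ffunE mulr1.
Qed.

Lemma mulchar_mul_subproof (chi psi : mulchar) :
  is_mulchar [ffun u => mulchar_val chi u * mulchar_val psi u].
Proof.
apply/andP; split; apply/forallP => u.
  by rewrite ffunE mulf_neq0 ?mulchar_neq0.
by apply/forallP => v; rewrite !ffunE !mulcharM mulrACA.
Qed.

Lemma mulchar_inv_subproof (chi : mulchar) :
  is_mulchar [ffun u => (mulchar_val chi u)^-1].
Proof.
apply/andP; split; apply/forallP => u.
  by rewrite ffunE invr_eq0 mulchar_neq0.
by apply/forallP => v; rewrite !ffunE mulcharM invfM.
Qed.

Definition mulchar_one := MulChar mulchar_one_subproof.
Definition mulchar_mul chi psi := MulChar (mulchar_mul_subproof chi psi).
Definition mulchar_inv chi := MulChar (mulchar_inv_subproof chi).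

Lemma mulchar_mulA : associative mulchar_mul.
Proof.
by move=> a b c; apply/val_inj/ffunP => u; rewrite !ffunE mulrA.
Qed.

Lemma mulchar_mul1 : left_id mulchar_one mulchar_mul.
Proof. by move=> a; apply/val_inj/ffunP => u; rewrite !ffunE mul1r. Qed.

Lemma mulchar_mulV : left_inverse mulchar_one mulchar_inv mulchar_mul.
Proof.
move=> a; apply/val_inj/ffunP => u.
by rewrite !ffunE mulVf ?mulchar_neq0.
Qed.

HB.instance Definition _ :=
  Finite_isGroup.Build mulchar mulchar_mulA mulchar_mul1 mulchar_mulV.

Definition charF (chi : mulchar) (x : F) : C :=
  if insub x is Some u then mulchar_val chi u else 0.

(* A character is applied to elements of F, with value 0 at 0. *)
Coercion charF : mulchar >-> Funclass.

End MulChar.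

Section Trace.
Variables (F : finFieldType) (p : nat) (pcharF : p \in [pchar F]).
Local Notation L := (pPrimeCharType pcharF).

(* galTrace takes its values in the line 1%VS of L; its coordinate on the
   basis [:: 1] is the trace as an element of 'F_p (see Ftr_galTrace). *)
Definition Ftr (a : F) : 'F_p :=
  coord [tuple (1 : L)] ord0 (galTrace 1%AS {:L}%AS (a : L)).

Lemma Ftr_galTrace (a : F) : (Ftr a)%:A = galTrace 1%AS {:L}%AS (a : L).
Proof.
have galL : galois 1%AS {:L}%AS by exact: finField_galois (sub1v _).
have := mem_galTrace galL (memvf (a : L)).
move=> tr1; have : galTrace 1%AS {:L}%AS (a : L) \in <<[tuple (1%R : L)]>>%VS.
  rewrite span_seq1; exact: tr1.
by move/coord_span; rewrite big_ord1 => /esym.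
Qed.

End Trace.

Section Appell.
Variables (F : finFieldType) (p : nat) (pcharF : p \in [pchar F]).
Variables (Cx : closedFieldType) (zeta : Cx).
Local Notation mchar := (mulchar F Cx).

Definition theta (a : F) : Cx := zeta ^+ (Ftr pcharF a : nat).

Definition gauss (chi : mchar) : Cx := \sum_(t : F) chi t * theta t.

Local Notation g := gauss.
Local Notation q := (#|F|%:R : Cx).

Definition appellF1 (A B B' C : mchar) (x y : F) : Cx :=
  ((q - 1) ^+ 2)^-1 * \sum_(psi : mchar) \sum_(chi : mchar)
    (g (A * chi * psi)%g * g (B * psi)%g * g (B' * chi)%g
       * g (C * chi * psi)^-1%g * g psi^-1%g * g chi^-1%g)
    / (g A * g B * g B' * g C^-1%g) * psi x * chi y.

Definition appellF4 (A B C C' : mchar) (x y : F) : Cx :=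
  ((q - 1) ^+ 2)^-1 * \sum_(psi : mchar) \sum_(chi : mchar)
    (g (A * chi * psi)%g * g (B * chi * psi)%g * g (C * psi)^-1%g
       * g (C' * chi)^-1%g * g psi^-1%g * g chi^-1%g)
    / (g A * g B * g C^-1%g * g C'^-1%g) * psi x * chi y.

End Appell.

(* Main.v *)
Require Import Defs.
From mathcomp Require Import all_boot all_order all_algebra all_fingroup.
From mathcomp Require Import all_solvable all_field.
From mathcomp Require Import reals complex ring.

Set Implicit Arguments.
Unset Strict Implicit.
Unset Printing Implicit Defensive.

Import GRing.Theory FinRing.Theory.
Local Open Scope ring_scope.

(** Gauss sums are the Mellin transforms of the additive character [theta]
    ([mellin_gauss], a form of the orthogonality of characters). Hence a sum
    over characters of a product of Gauss sums can be rewritten as a sum over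
    the field of characters of polynomials, just as hypergeometric series turn
    into Euler integrals. The theorem then becomes a change of variables
    between two such sums.

    For [F1] the double sum over characters collapses to a sum over one
    variable [z] of characters of [z], [1 + z], [1 + z x] and [1 + z x y]
    ([appellF1_sum]). Each step evaluates the Gauss sum of a quotient of two
    parameters, and these quotients are nontrivial because [B], [C] and [C], [A]
    are distinct.

    For [F4] with equal parameters [B] and [C' = B], the same procedure leaves
    two variables [k], [l] and a twisted Gauss sum of the trivial character. The
    latter equals [q] on the curve [1 + k + k l X = 0] minus [1] everywhere
    ([appellF4_numerator]). The [- 1] integrates to a product of Gauss sums
    ([appellF4_correction]), and after division by [g B^-1] this is the extra
    term of the theorem. What remains is a sum over the curve, which has a
    rational parametrization. For [X = - x / u] and [Y = - y / u] with
    [u = (1 - x) (1 - y)] the quadratic polynomial under the character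
    [A^-1 C] factors along it as [(1 + z) (1 + z x y)], and the sum becomes
    [B (-1) A u] times the sum for [F1] ([rational_curve_sum]). *)

(** * Multiplicative characters as functions on the field *)

Section CharacterAlgebra.
Variables (F : finFieldType) (Cx : closedFieldType).
Implicit Types (chi psi A B C : mulchar F Cx) (x y u : F).

Lemma charF_unit chi (v : {unit F}) : chi (val v) = mulchar_val chi v.
Proof. by rewrite /charF valK. Qed.

Lemma charF0 chi : chi 0 = 0.
Proof. by rewrite /charF insubF // unitr0. Qed.

Lemma unit_valE x : x != 0 -> exists v : {unit F}, x = val v.
Proof. by rewrite -unitfE => Ux; exists (FinRing.Unit Ux). Qed.

Lemma charF_eq0 chi x : (chi x == 0) = (x == 0).
Proof.
have [->|/unit_valE[v ->]] := eqVneq x 0; first by rewrite charF0 eqxx.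
by rewrite charF_unit (negbTE (mulchar_neq0 _ _)).
Qed.

Lemma charFM chi x y : chi (x * y) = chi x * chi y.
Proof.
have [->|/unit_valE[v ->]] := eqVneq x 0; first by rewrite mul0r charF0 mul0r.
have [->|/unit_valE[w ->]] := eqVneq y 0; first by rewrite mulr0 charF0 mulr0.
by rewrite -[_ * _]/(val (v * w)%g) !charF_unit mulcharM.
Qed.

Lemma charF1 chi : chi 1 = 1.
Proof. by rewrite -[1]/(val (1%g : {unit F})) charF_unit mulchar1. Qed.

Lemma charFV chi x : chi x^-1 = (chi x)^-1.
Proof.
have [->|x_neq0] := eqVneq x 0; first by rewrite invr0 charF0 invr0.
have chix_neq0 : chi x != 0 by rewrite charF_eq0.
by apply: (mulIf chix_neq0); rewrite -charFM !mulVf ?charF1.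
Qed.

Lemma charF_mul chi psi x : (chi * psi)%g x = chi x * psi x.
Proof.
have [->|/unit_valE[v ->]] := eqVneq x 0; first by rewrite !charF0 mul0r.
by rewrite !charF_unit /= ffunE.
Qed.

Lemma charF_inv chi x : chi^-1%g x = (chi x)^-1.
Proof.
have [->|/unit_valE[v ->]] := eqVneq x 0; first by rewrite !charF0 invr0.
by rewrite !charF_unit /= ffunE.
Qed.

Lemma charF_one x : (1%g : mulchar F Cx) x = (x != 0)%:R.
Proof.
have [->|/unit_valE[v ->]] := eqVneq x 0; first by rewrite charF0.
by rewrite charF_unit ffunE.
Qed.

Lemma mulchar_mulC chi psi : (chi * psi = psi * chi)%g.
Proof. by apply/val_inj/ffunP => v; rewrite !ffunE mulrC. Qed.

Lemma charF_inj chi psi : (forall x, chi x = psi x) -> chi = psi.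
Proof.
by move=> eq_chi; apply/val_inj/ffunP => v; have := eq_chi (val v); rewrite !charF_unit.
Qed.

Lemma charF_neq1P chi : chi <> 1%g -> exists2 x, x != 0 & chi x != 1.
Proof.
move=> chi_neq1; apply/exists_inP; apply: contra_notT chi_neq1.
move=> /exists_inPn chi1; apply: charF_inj => x; rewrite charF_one.
have [->|x_neq0] := eqVneq x 0; first by rewrite charF0.
by apply/eqP; rewrite -[_ == _]negbK chi1.
Qed.

Lemma reindex_mulf (S : nmodType) (f : F -> S) c : c != 0 ->
  \sum_x f x = \sum_x f (x * c).
Proof.
by move=> c_neq0; rewrite (reindex_inj (mulIf c_neq0)).
Qed.

Lemma reindex_addf (S : nmodType) (f : F -> S) c :
  \sum_x f x = \sum_x f (x + c).
Proof. by rewrite (reindex_inj (addIr c)). Qed.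

(** Multiplying the argument by [c] with [chi c != 1] permutes the terms and
    multiplies the sum by [chi c]. *)
Lemma sum_charF chi : chi <> 1%g -> \sum_x chi x = 0.
Proof.
move=> /charF_neq1P[c c_neq0 chic].
have /eqP := reindex_mulf (charF chi) c_neq0.
under [X in _ == X]eq_bigr do rewrite charFM.
rewrite -mulr_suml -subr_eq0 -{1}[\sum_x _]mulr1 -mulrBr mulf_eq0.
by rewrite subr_eq0 [1 == _]eq_sym (negbTE chic) orbF => /eqP.
Qed.

Lemma mulgV_neq1 A C : A <> C -> (A * C^-1)%g <> 1%g.
Proof. by move=> A_neq_C /eqP; rewrite -eq_mulgV1 => /eqP. Qed.

Lemma twist_ratio A C psi : ((A * psi) * (C * psi)^-1 = A * C^-1)%g.
Proof. by rewrite invMg mulgA mulgK. Qed.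

Lemma twist_ratioV A C psi : ((A * psi)^-1 * (C * psi) = A^-1 * C)%g.
Proof. by rewrite ![(_ * psi)%g]mulchar_mulC invMg mulgA mulgKV. Qed.

Lemma charF_neg_div B y u : u != 0 -> y != 0 ->
  B (-1) * B^-1%g (- y / u) = B^-1%g y * B u.
Proof.
move=> u_neq0 y_neq0; have -> : - y / u = -1 * (y / u) by rewrite mulN1r mulNr.
rewrite !charF_inv !charFM charFV; field.
by rewrite !charF_eq0 u_neq0 y_neq0 oppr_eq0 oner_neq0.
Qed.

End CharacterAlgebra.

(** * Duality of the multiplicative group *)

Section Orthogonality.
Variables (F : finFieldType) (Cx : numClosedFieldType).
Implicit Types (chi psi : mulchar F Cx) (x y : F).

Lemma prim_root_exists n : (0 < n)%N -> exists w : Cx, n.-primitive_root w.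
Proof.
move=> n_gt0; have [s Es] := closed_field_poly_normal ('X^n - 1 : {poly Cx}).
have {}Es : 'X^n - 1 = \prod_(z <- s) ('X - z%:P).
  by rewrite Es lead_coefXnsubC // scale1r.
have [||||w _ ?] := @hasP _ _ _ (@has_prim_root _ n s _ _ _ _); last by exists w.
- by [].
- apply/allP => z; rewrite -root_prod_XsubC -Es.
  by rewrite /root !hornerE subr_eq0 unity_rootE.
- rewrite -separable_prod_XsubC -Es; apply: separable_Xn_sub_1.
  by rewrite Num.Theory.pnatr_eq0 -lt0n.
- by rewrite -ltnS -(size_prod_XsubC s id) -Es size_XnsubC.
Qed.

(** The group of units is cyclic: for a generator [c] and a primitive root of
    unity [w] of the same order, [c ^ k |-> w ^ k] is a faithful character, so
    that this one character separates every [x] from [1]. *)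
Lemma mulchar_separates x : x != 0 -> x != 1 -> exists chi, chi x != 1.
Proof.
move=> /unit_valE[u ->] u_neq1.
have /cyclicP[c genc] := field_unit_group_cyclic [set: {unit F}]%G.
have [w w_prim] := prim_root_exists (order_gt0 c).
have log_exists (v : {unit F}) : exists k, v == (c ^+ k)%g.
  have /cycleP[k ->] : v \in <[c]>%g by rewrite -genc inE.
  by exists k.
pose log v := xchoose (log_exists v).
have logK v : (c ^+ log v)%g = v by rewrite -(eqP (xchooseP (log_exists v))).
have chi_subproof : is_mulchar [ffun v => w ^+ log v].
  apply/andP; split; apply/forallP => v.
    rewrite ffunE expf_neq0 //; apply/eqP => w0; have /eqP := prim_expr_order w_prim.
    by rewrite w0 expr0n gtn_eqF ?order_gt0 // eq_sym oner_eq0.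
  apply/forallP => v'; rewrite !ffunE -exprD (eq_prim_root_expr w_prim).
  by rewrite -eq_expg_mod_order expgD !logK.
exists (MulChar chi_subproof); rewrite charF_unit ffunE -(expr0 w).
rewrite (eq_prim_root_expr w_prim) -eq_expg_mod_order logK expg0.
by apply: contra u_neq1 => /eqP ->.
Qed.

Lemma natr_unit_card : #|[set: {unit F}]|%:R = #|F|%:R - 1 :> Cx.
Proof.
rewrite card_finField_unit -subn1 natrB //.
by apply/card_gt0P; exists 0.
Qed.

Lemma sum_charF_one : \sum_x (1%g : mulchar F Cx) x = #|F|%:R - 1.
Proof.
under eq_bigr do rewrite charF_one.
rewrite -natr_unit_card card_finField_unit -natr_sum; congr _%:R.
rewrite (bigD1 0) //= eqxx add0n (eq_bigr (fun=> 1%N)) => [|x ->] //.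
by rewrite sum1_card -[#|F|](cardC (pred1 0)) card1 add1n.
Qed.

Lemma orthogonality_neq1 x : x != 1 -> \sum_chi charF chi x = 0 :> Cx.
Proof.
move=> x_neq1; have [->|x_neq0] := eqVneq x 0.
  by rewrite big1 // => chi _; rewrite charF0.
have [psi psix] := mulchar_separates x_neq0 x_neq1.
have : \sum_chi charF chi x = psi x * \sum_chi charF chi x.
  rewrite {1}(reindex_inj (mulgI psi)) mulr_sumr.
  by apply: eq_bigr => chi _; rewrite charF_mul.
move/eqP; rewrite -subr_eq0 -{1}[\sum_chi _]mul1r -mulrBl mulf_eq0.
by rewrite subr_eq0 [1 == _]eq_sym (negbTE psix) => /eqP.
Qed.

(** Double counting of the sum of all values [chi x]: grouped by [chi] only the
    trivial character contributes, grouped by [x] only [x = 1] does. *)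
Lemma card_mulchar : #|{: mulchar F Cx}|%:R = #|F|%:R - 1 :> Cx.
Proof.
rewrite -sum_charF_one.
have : \sum_(chi : mulchar F Cx) \sum_x chi x = \sum_x (1%g : mulchar F Cx) x.
  rewrite (bigD1 1%g) //= [X in _ + X]big1 ?addr0 // => chi /eqP.
  exact: sum_charF.
rewrite exchange_big (bigD1 1) //= [X in _ + X]big1 ?addr0 => [<-|]; last first.
  by move=> x; apply: orthogonality_neq1.
under eq_bigr do rewrite charF1.
by rewrite sumr_const.
Qed.

Lemma orthogonality x :
  \sum_chi charF chi x = (#|F|%:R - 1) * (x == 1)%:R :> Cx.
Proof.
have [->|x_neq1] := eqVneq x 1; last by rewrite orthogonality_neq1 // mulr0.
under eq_bigr do rewrite charF1.
by rewrite sumr_const card_mulchar mulr1.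
Qed.

End Orthogonality.

(** * The additive character *)

Section AdditiveCharacter.
Variables (F : finFieldType) (p : nat) (pcharF : p \in [pchar F]).
Variables (Cx : closedFieldType) (zeta : Cx).
Hypothesis zeta_prim : p.-primitive_root zeta.
Local Notation L := (pPrimeCharType pcharF).
Local Notation th := (theta pcharF zeta).
Implicit Types x y z : F.

Lemma FtrD x y : Ftr pcharF (x + y) = Ftr pcharF x + Ftr pcharF y.
Proof.
rewrite /Ftr -[RHS]raddfD; congr (coord _ _ _).
exact: (raddfD (galTrace 1%AS {:L}%AS) (x : L) (y : L)).
Qed.

(** The trace is a combination of distinct automorphisms with coefficients [1],
    hence not identically zero by independence of automorphisms. *)
Lemma Ftr_neq0 : exists x, Ftr pcharF x != 0.
Proof.
have [a _ tra] := @gal_independent_contra _ L {:L}%AS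
  [in 'Gal({:L} / 1)%g] (fun=> 1) 1%g (group1 _) (oner_neq0 _).
exists a; apply: contraNneq tra => tra.
have := Ftr_galTrace pcharF a; rewrite tra scale0r => /esym tra0.
by apply/eqP; rewrite -[RHS]tra0; apply: eq_bigr => s _; rewrite mul1r.
Qed.

Lemma thetaD x y : th (x + y) = th x * th y.
Proof.
rewrite /theta -exprD FtrD; apply/eqP.
rewrite (eq_prim_root_expr zeta_prim).
suff -> : (Ftr pcharF x + Ftr pcharF y : 'F_p) =
    ((Ftr pcharF x + Ftr pcharF y) %% p)%N :> nat by rewrite modn_mod.
by congr (_ %% _)%N; rewrite Fp_cast ?(pcharf_prime pcharF).
Qed.

Lemma theta0 : th 0 = 1.
Proof.
have Ftr0 : Ftr pcharF 0 = 0.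
  by apply: (addrI (Ftr pcharF 0)); rewrite -FtrD !addr0.
by rewrite /theta Ftr0 expr0.
Qed.

Lemma theta_neq1 : exists x, th x != 1.
Proof.
have [x trx] := Ftr_neq0; exists x; apply: contra trx.
rewrite /theta -(expr0 zeta) (eq_prim_root_expr zeta_prim) mod0n modn_small.
  by move=> /eqP trx0; apply/eqP/val_inj.
by rewrite -[X in (_ < X)%N](Fp_cast (pcharf_prime pcharF)) ltn_ord.
Qed.

Lemma sum_theta : \sum_x th x = 0.
Proof.
have [c thc] := theta_neq1; have /eqP := reindex_addf th c.
under [X in _ == X]eq_bigr do rewrite thetaD.
rewrite -mulr_suml -subr_eq0 -{1}[\sum_x _]mulr1 -mulrBr mulf_eq0.
by rewrite subr_eq0 [1 == _]eq_sym (negbTE thc) orbF => /eqP.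
Qed.

Lemma sum_theta_mul z : \sum_x th (x * z) = #|F|%:R * (z == 0)%:R.
Proof.
have [->|z_neq0] := eqVneq z 0.
  under eq_bigr do rewrite mulr0 theta0.
  by rewrite sumr_const mulr1.
by rewrite -reindex_mulf // sum_theta mulr0.
Qed.

(** The Gauss sum of the trivial character with an additive twist. The [- 1],
    which is the missing term [x = 0], is the source of the correction term in
    the reduction formula. *)
Lemma sum_theta_mul_neq0 z :
  \sum_x (x != 0)%:R * th (x * z) = #|F|%:R * (z == 0)%:R - 1.
Proof.
rewrite -sum_theta_mul; apply: (canRL (addrK 1)).
rewrite (bigD1 0) //= [RHS](bigD1 0) //= eqxx mul0r add0r mul0r theta0 addrC.
by congr (_ + _); apply: eq_bigr => x ->; rewrite mul1r.
Qed.

End AdditiveCharacter.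

(** * Gauss sums *)

Section GaussSums.
Variables (F : finFieldType) (p : nat) (pcharF : p \in [pchar F]).
Variables (Cx : numClosedFieldType) (zeta : Cx).
Hypothesis zeta_prim : p.-primitive_root zeta.
Local Notation th := (theta pcharF zeta).
Local Notation g := (gauss pcharF zeta).
Local Notation q := (#|F|%:R : Cx).
Implicit Types (chi psi A B C : mulchar F Cx) (x y z a k w : F).

(** At [z = 0] both sides vanish, and this is where [chi] has to be nontrivial:
    the left-hand side is then the plain sum of the values of [chi]. *)
Lemma gauss_scaled chi z : chi <> 1%g ->
  \sum_w chi w * th (w * z) = chi^-1%g z * g chi.
Proof.
move=> chi_neq1; have [->|z_neq0] := eqVneq z 0.
  under eq_bigr do rewrite mulr0 theta0 // mulr1.
  by rewrite sum_charF // charF0 mul0r.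
rewrite charF_inv /gauss [in RHS](reindex_mulf _ z_neq0) mulr_sumr.
apply: eq_bigr => w _; rewrite charFM mulrA mulrCA.
by rewrite mulVf ?charF_eq0 // mulr1.
Qed.

Lemma gauss_one : g 1%g = -1.
Proof.
have := sum_theta_mul_neq0 pcharF zeta_prim 1.
rewrite oner_eq0 mulr0 sub0r => <-.
by apply: eq_bigr => x _; rewrite charF_one mulr1.
Qed.

(** Absorb [chi^-1 t * g chi] into a twisted sum by [gauss_scaled]; summing over
    [t] first then leaves the single point [w = -1]. *)
Lemma gauss_mulV chi : chi <> 1%g -> g chi * g chi^-1%g = chi (-1) * q.
Proof.
move=> chi_neq1; rewrite mulrC {1}/gauss mulr_suml.
transitivity (\sum_w \sum_t chi w * th (t * (1 + w))).
  rewrite exchange_big; apply: eq_bigr => t _ /=.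
  rewrite mulrAC -gauss_scaled // mulr_suml; apply: eq_bigr => w _.
  by rewrite mulrDr mulr1 thetaD // [t * w]mulrC; ring.
rewrite (bigD1 (-1)) //= [X in _ + X]big1 ?addr0 => [|w w_neqN1].
  by rewrite -mulr_sumr sum_theta_mul // subrr eqxx mulr1.
by rewrite -mulr_sumr sum_theta_mul // addrC addr_eq0 (negbTE w_neqN1) !mulr0.
Qed.

Lemma card_neq0 : q != 0.
Proof.
by rewrite Num.Theory.pnatr_eq0 -lt0n; apply/card_gt0P; exists 0.
Qed.

Lemma card1_neq0 : q - 1 != 0.
Proof. by rewrite -natr_unit_card Num.Theory.pnatr_eq0 -lt0n cardG_gt0. Qed.

Lemma gauss_neq0 chi : g chi != 0.
Proof.
have [->|/eqP chi_neq1] := eqVneq chi 1%g; first by rewrite gauss_one oppr_eq0 oner_neq0.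
have : g chi * g chi^-1%g != 0.
  by rewrite gauss_mulV // mulf_neq0 ?card_neq0 // charF_eq0 oppr_eq0 oner_neq0.
by rewrite mulf_eq0; case/norP.
Qed.

(** Fourier inversion on the multiplicative group: [g psi^-1] is the Mellin
    transform of [theta]. The factor [(a != 0)%:R] appears because characters
    vanish at [0] while [theta] does not. *)
Lemma mellin_gauss a :
  \sum_psi g psi^-1%g * psi a = (q - 1) * ((a != 0)%:R * th a).
Proof.
transitivity (\sum_t th t * \sum_psi charF psi (a / t)).
  under [RHS]eq_bigr do rewrite mulr_sumr.
  rewrite exchange_big; apply: eq_bigr => psi _; rewrite mulr_suml.
  by apply: eq_bigr => t _; rewrite charF_inv charFM charFV; ring.
under eq_bigr do rewrite orthogonality.
have [->|a_neq0] /= := eqVneq a 0.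
  rewrite mul0r mulr0 big1 // => t _.
  by rewrite mul0r eq_sym oner_eq0 !mulr0.
rewrite (bigD1 a) //= divff // eqxx mulr1 mul1r mulrC.
rewrite [X in _ + X]big1 ?addr0 // => t t_neqa.
have [->|t_neq0] := eqVneq t 0; first by rewrite invr0 mulr0 eq_sym oner_eq0 !mulr0.
have [/(canRL (divfK t_neq0)) a_t|_] := eqVneq (a / t) 1; last by rewrite !mulr0.
by move: t_neqa; rewrite a_t mul1r eqxx.
Qed.

(** Substitute [s = w * k] in the double sum over [s] and [w]. Keeping the inner
    sum unevaluated covers the case [A = C], which occurs when [A] and [C] are
    themselves twisted by a summation character. *)
Lemma gauss_mul_inv A C :
  g A * g C^-1%g = \sum_k A k * \sum_w (A * C^-1)%g w * th (w * (1 + k)).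
Proof.
under [RHS]eq_bigr do rewrite mulr_sumr.
rewrite exchange_big mulrC {1}/gauss mulr_suml; apply: eq_bigr => w _ /=.
have [->|w_neq0] := eqVneq w 0.
  by rewrite charF0 !mul0r big1 // => k _; rewrite charF0 mul0r mulr0.
rewrite {1}/gauss (reindex_mulf _ w_neq0) mulr_sumr.
apply: eq_bigr => k _; rewrite charFM charF_mul mulrDr mulr1 thetaD // [k * w]mulrC.
ring.
Qed.

(** The classical expression of a product of two Gauss sums by a Jacobi sum,
    written on the line [k, 1 + k] instead of [k, 1 - k] so that no signs
    [C (-1)] arise. *)
Lemma gauss_mul_jacobi A C : A <> C ->
  g A * g C^-1%g = g (A * C^-1)%g * \sum_k A k * (A^-1 * C)%g (1 + k).
Proof.
move=> A_neq_C; rewrite gauss_mul_inv mulr_sumr; apply: eq_bigr => k _.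
rewrite gauss_scaled; last exact: mulgV_neq1.
by rewrite invMg invgK [(C * _)%g]mulchar_mulC; ring.
Qed.

(** The finite field binomial theorem: with Gauss sums in the role of values of
    the Gamma function, the left-hand side is the series of [(1 + z) ^ (- b)]. *)
Lemma mellin_binomial B z : B <> 1%g -> z != 0 ->
  \sum_psi g (B * psi)%g * g psi^-1%g * psi z = (q - 1) * (g B * B^-1%g (1 + z)).
Proof.
move=> B_neq1 z_neq0.
transitivity (\sum_psi g B * \sum_k B k * B^-1%g (1 + k) * charF psi (k * z)).
  apply: eq_bigr => psi _; rewrite gauss_mul_jacobi; last first.
    by rewrite -[RHS]mul1g => /mulIg.
  rewrite mulgK invMg [(psi^-1 * _)%g]mulchar_mulC mulgKV -mulrA; congr (_ * _); rewrite mulr_suml.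
  by apply: eq_bigr => k _; rewrite charF_mul charFM; ring.
rewrite -mulr_sumr exchange_big /=.
under eq_bigr do rewrite -mulr_sumr orthogonality.
rewrite mulrCA; congr (_ * _); rewrite (bigD1 z^-1) //= mulVf // eqxx.
rewrite [X in _ + X]big1 ?addr0 => [|k k_neqVz]; last first.
  rewrite -(mulVf z_neq0) (inj_eq (mulIf z_neq0)) (negbTE k_neqVz).
  by rewrite !mulr0.
rewrite mulr1 mulrC; congr (_ * _).
have [zN1|z_neqN1] := eqVneq (1 + z) 0.
  have -> : 1 + z^-1 = 0 by apply: (mulIf z_neq0); rewrite mulrDl mul1r mulVf // addrC mul0r.
  by rewrite zN1 charF0 mulr0.
rewrite (_ : 1 + z = z * (1 + z^-1)).
  by rewrite !charF_inv charFM charFV invfM.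
by rewrite mulrDr mulr1 divff // addrC.
Qed.

End GaussSums.

(** * Appell functions as character sums over the field *)

Section AppellSums.
Variables (F : finFieldType) (p : nat) (pcharF : p \in [pchar F]).
Variables (Cx : numClosedFieldType) (zeta : Cx).
Hypothesis zeta_prim : p.-primitive_root zeta.
Local Notation th := (theta pcharF zeta).
Local Notation g := (gauss pcharF zeta).
Local Notation q := (#|F|%:R : Cx).
Implicit Types (chi psi A B C : mulchar F Cx) (x y z k l v w : F).

(** The analogue of the Picard integral of [F1]. The Gauss sums that involve both
    summation characters form a ratio, which [gauss_mul_jacobi] turns into one
    sum over [k]; the remaining double series then splits into two binomial
    series, in [k * x] and in [k * y]. *)
Lemma appellF1_sum A B B' C x y :
  A <> C -> B <> 1%g -> B' <> 1%g -> x != 0 -> y != 0 ->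
  appellF1 pcharF zeta A B B' C x y =
    g (A * C^-1)%g / (g A * g C^-1%g) *
    \sum_k A k * (A^-1 * C)%g (1 + k) * B^-1%g (1 + k * x) * B'^-1%g (1 + k * y).
Proof.
move=> A_neq_C B_neq1 B'_neq1 x_neq0 y_neq0; rewrite /appellF1.
set D := (g A * g B * g B' * g C^-1%g)^-1.
pose K := g (A * C^-1)%g * D.
pose T k := A k * (A^-1 * C)%g (1 + k).
transitivity (((q - 1) ^+ 2)^-1 * \sum_k K * T k *
    ((\sum_psi g (B * psi)%g * g psi^-1%g * psi (k * x)) *
     (\sum_chi g (B' * chi)%g * g chi^-1%g * chi (k * y)))).
  congr (_ * _); under [RHS]eq_bigr do rewrite big_distrlr mulr_sumr.
  rewrite [RHS]exchange_big; apply: eq_bigr => psi _ /=.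
  under [RHS]eq_bigr do rewrite mulr_sumr.
  rewrite [RHS]exchange_big; apply: eq_bigr => chi _ /=.
  have ratio_neq : (A * chi * psi)%g <> (C * chi * psi)%g by move=> /mulIg/mulIg.
  have := gauss_mul_jacobi pcharF zeta_prim ratio_neq.
  rewrite !twist_ratio !twist_ratioV; set J := \sum_k _ => EJ.
  transitivity (K * J * ((g (B * psi)%g * g psi^-1%g * psi x) *
                         (g (B' * chi)%g * g chi^-1%g * chi y))).
    transitivity (g (A * chi * psi)%g * g (C * chi * psi)^-1%g * D *
      ((g (B * psi)%g * g psi^-1%g * psi x) * (g (B' * chi)%g * g chi^-1%g * chi y))).
      ring.
    by rewrite EJ /K; ring.
  rewrite /J mulr_sumr mulr_suml; apply: eq_bigr => k _.
  by rewrite /T !charF_mul !charFM; ring.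
have K_def : K * (g B * g B') = g (A * C^-1)%g / (g A * g C^-1%g).
  by rewrite /K /D; field; rewrite !gauss_neq0.
rewrite -K_def [LHS]mulr_sumr [RHS]mulr_sumr; apply: eq_bigr => k _.
have [->|k_neq0] := eqVneq k 0; first by rewrite /T !charF0 !(mul0r, mulr0).
rewrite !mellin_binomial ?mulf_neq0 // /T.
by field; rewrite card1_neq0.
Qed.

(** The shape in which two applications of [gauss_mul_inv] get multiplied out. *)
Lemma mulr_sum4 (I : finType) (R : comPzRingType) (a c : I -> R)
    (b d : I -> I -> R) (e : R) :
  (\sum_k c k * \sum_w d k w) * (\sum_l a l * \sum_v b l v) * e =
  \sum_k \sum_l \sum_v \sum_w c k * d k w * (a l * b l v) * e.
Proof.
rewrite big_distrlr mulr_suml; apply: eq_bigr => k _.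
rewrite mulr_suml; apply: eq_bigr => l _ /=.
rewrite mulrACA [X in _ * X * e]mulrC big_distrlr mulr_sumr mulr_suml.
apply: eq_bigr => v _; rewrite mulr_sumr mulr_suml; apply: eq_bigr => w _ /=.
ring.
Qed.

(** Pair the Gauss sums as [A chi psi] with [C psi] and [B chi psi] with [B chi].
    Because the parameters [B] and [C'] of the function agree, the second ratio
    is just [psi]. Mellin inversion in [psi] therefore leaves only the indicator
    of [w != 0] in the sum over [w], which [sum_theta_mul_neq0] evaluates. *)
Lemma appellF4_numerator A B C X Y : X != 0 -> Y != 0 ->
  \sum_psi \sum_chi g (A * chi * psi)%g * g (B * chi * psi)%g * g (C * psi)^-1%g
      * g (B * chi)^-1%g * g psi^-1%g * g chi^-1%g * psi X * chi Y =
  (q - 1) ^+ 2 * \sum_k \sum_l B k * A l * (q * (1 + k + k * l * X == 0)%:R - 1)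
     * \sum_v (A * C^-1)%g v * th (v * (1 + l + k * l * Y)).
Proof.
move=> X_neq0 Y_neq0.
pose T k l v w := B k * A l * ((A * C^-1)%g v * th (v * (1 + l))) * th (w * (1 + k)).
transitivity (\sum_k \sum_l \sum_v \sum_w T k l v w *
   ((\sum_psi g psi^-1%g * psi (k * l * w * X)) *
    (\sum_chi g chi^-1%g * chi (k * l * v * Y)))).
  transitivity (\sum_(pc : mulchar F Cx * mulchar F Cx)
     \sum_k \sum_l \sum_v \sum_w T k l v w *
       ((g pc.1^-1%g * pc.1 (k * l * w * X)) *
        (g pc.2^-1%g * pc.2 (k * l * v * Y)))); last first.
    rewrite exchange_big; apply: eq_bigr => k _.
    rewrite exchange_big; apply: eq_bigr => l _.
    rewrite exchange_big; apply: eq_bigr => v _.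
    rewrite exchange_big; apply: eq_bigr => w _ /=.
    by rewrite -mulr_sumr big_distrlr pair_bigA.
  rewrite pair_bigA; apply: eq_bigr => -[psi chi] _ /=.
  have := gauss_mul_inv pcharF zeta_prim (A * chi * psi)%g (C * psi)%g.
  have := gauss_mul_inv pcharF zeta_prim (B * chi * psi)%g (B * chi)%g.
  set GB := \sum_k _ => EB; set GA := \sum_k _ => EA.
  transitivity (GB * GA * (g psi^-1%g * g chi^-1%g * psi X * chi Y)).
    by rewrite -EA -EB; ring.
  rewrite mulr_sum4; apply: eq_bigr => k _; apply: eq_bigr => l _.
  apply: eq_bigr => v _; apply: eq_bigr => w _.
  rewrite twist_ratio [(B * chi * psi)%g]mulchar_mulC mulgK /T !charF_mul !charFM.
  ring.
rewrite mulr_sumr; apply: eq_bigr => k _; rewrite mulr_sumr; apply: eq_bigr => l _.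
rewrite -(sum_theta_mul_neq0 pcharF zeta_prim) [X in _ = _ * X]mulr_sumr [RHS]mulr_sumr.
apply: eq_bigr => v _.
rewrite [X in _ = _ * (X * _)]mulr_sumr [X in _ = _ * X]mulr_suml [RHS]mulr_sumr.
apply: eq_bigr => w _.
rewrite !mellin_gauss // /T !mulf_eq0 (negbTE X_neq0) (negbTE Y_neq0) !orbF.
(* When [k], [l] or [v] vanishes, Mellin inversion gives [0] instead of a
   value of theta, but so does the factor [T k l v w]. *)
have [->|k_neq0] := eqVneq k 0; first by rewrite charF0; ring.
have [->|l_neq0] := eqVneq l 0; first by rewrite charF0; ring.
have [->|v_neq0] := eqVneq v 0; first by rewrite charF0; ring.
have -> : w * (1 + k + k * l * X) = w * (1 + k) + k * l * w * X by ring.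
have -> : v * (1 + l + k * l * Y) = v * (1 + l) + k * l * v * Y by ring.
by rewrite !(thetaD pcharF zeta_prim) /=; ring.
Qed.

(** Summing over [k], then [l], then [v] peels off one Gauss sum at a time. *)
Lemma appellF4_correction A B C Y : A <> B -> B <> 1%g -> Y != 0 ->
  \sum_k \sum_l B k * A l * \sum_v (A * C^-1)%g v * th (v * (1 + l + k * l * Y)) =
  g B * g (A * B^-1)%g * g C^-1%g * B^-1%g Y.
Proof.
move=> A_neq_B B_neq1 Y_neq0.
transitivity (\sum_v (A * C^-1)%g v * th v * \sum_l A l * th (l * v) *
   \sum_k B k * th (k * (l * v * Y))).
  under eq_bigr do under eq_bigr do rewrite mulr_sumr.
  under eq_bigr do rewrite exchange_big.
  rewrite exchange_big; apply: eq_bigr => v _; rewrite exchange_big [RHS]mulr_sumr.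
  apply: eq_bigr => l _ /=; rewrite [X in _ = _ * X]mulr_sumr [RHS]mulr_sumr.
  apply: eq_bigr => k _.
  have -> : v * (1 + l + k * l * Y) = v + l * v + k * (l * v * Y) by ring.
  by rewrite !(thetaD pcharF zeta_prim); ring.
transitivity (\sum_v g B * B^-1%g Y * g (A * B^-1)%g * (C^-1%g v * th v)); last first.
  by rewrite -mulr_sumr -/(g C^-1%g); ring.
apply: eq_bigr => v _.
transitivity ((A * C^-1)%g v * th v * (g B * B^-1%g Y * B^-1%g v *
   \sum_l (A * B^-1)%g l * th (l * v))).
  congr (_ * _); rewrite [RHS]mulr_sumr; apply: eq_bigr => l _.
  by rewrite gauss_scaled // !charFM charF_mul; ring.
rewrite (gauss_scaled pcharF zeta) ?invMg ?invgK; last exact: mulgV_neq1.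
have [->|v_neq0] := eqVneq v 0; first by rewrite !charF0; ring.
rewrite !charF_mul !charF_inv; field.
by rewrite !charF_eq0 v_neq0 Y_neq0.
Qed.

(** The bracket [q * (_ == 0)%:R - 1] of [appellF4_numerator] splits the function
    into a sum over a plane curve and the product of Gauss sums computed in
    [appellF4_correction]. *)
Lemma appellF4_sum A B C X Y :
  A <> C -> A <> B -> B <> 1%g -> X != 0 -> Y != 0 ->
  appellF4 pcharF zeta A B C B X Y =
    g (A * C^-1)%g / (g A * g C^-1%g) * B (-1) *
      (\sum_k \sum_l B k * A l * (1 + k + k * l * X == 0)%:R *
         (A^-1 * C)%g (1 + l + k * l * Y))
    - g B * g (A * B^-1)%g / (q * g A) * (B (-1) * B^-1%g Y).
Proof.
move=> A_neq_C A_neq_B B_neq1 X_neq0 Y_neq0; rewrite /appellF4.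
set D := (g A * g B * g C^-1%g * g B^-1%g)^-1.
set S := \sum_k \sum_l B k * A l * _%:R * _.
have N_split : \sum_k \sum_l B k * A l * (q * (1 + k + k * l * X == 0)%:R - 1)
     * \sum_v (A * C^-1)%g v * th (v * (1 + l + k * l * Y)) =
   q * g (A * C^-1)%g * S - g B * g (A * B^-1)%g * g C^-1%g * B^-1%g Y.
  rewrite -appellF4_correction // [X in _ = X - _]mulr_sumr -sumrB.
  apply: eq_bigr => k _; rewrite [X in _ = X - _]mulr_sumr -sumrB.
  apply: eq_bigr => l _; rewrite gauss_scaled //; last exact: mulgV_neq1.
  by rewrite invMg invgK [(C * _)%g]mulchar_mulC; ring.
transitivity (((q - 1) ^+ 2)^-1 * ((q - 1) ^+ 2 *
   (q * g (A * C^-1)%g * S - g B * g (A * B^-1)%g * g C^-1%g * B^-1%g Y)) * D).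
  rewrite -N_split -appellF4_numerator // -mulrA; congr (_ * _).
  rewrite mulr_suml; apply: eq_bigr => psi _; rewrite mulr_suml.
  by apply: eq_bigr => chi _; ring.
have gBV : g B^-1%g = B (-1) * q / g B.
  by apply: (canRL (mulfK (gauss_neq0 pcharF zeta_prim _))); rewrite mulrC gauss_mulV.
(* [B (-1)] is its own inverse, so it can be moved out of the denominator. *)
have D_eq : D = B (-1) / (q * g A * g C^-1%g).
  rewrite /D gBV -[X in _ = X / _](invrK _) -charFV invrN1; field.
  by rewrite !gauss_neq0 // charF_eq0 oppr_eq0 oner_neq0 card_neq0.
rewrite D_eq; field.
by rewrite !gauss_neq0 // card_neq0 card1_neq0.
Qed.

(** The curve [1 + k + k l X = 0] is rational. In the parameter [z] with
    [k = - (1 + z x)] and [l = z u / (1 + z x)] one has [k l = - z u], and the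
    remaining factor [1 + l + k l Y] becomes
    [(1 + z) (1 + z x y) / (1 + z x)]: this factorization is what the special
    form of the arguments [X = - x / u] and [Y = - y / u] achieves. *)
Lemma rational_curve_sum A B C x y : x != 0 -> x != 1 -> y != 1 ->
  let u := (1 - x) * (1 - y) in
  \sum_k \sum_l B k * A l * (1 + k + k * l * (- x / u) == 0)%:R *
    (A^-1 * C)%g (1 + l + k * l * (- y / u)) =
  B (-1) * A u * \sum_z A z * (A^-1 * C)%g (1 + z) *
    (B^-1 * C)^-1%g (1 + z * x) * (A * C^-1)^-1%g (1 + z * (x * y)).
Proof.
move=> x_neq0 x_neq1 y_neq1 u.
have u_neq0 : u != 0 by rewrite mulf_neq0 // subr_eq0 eq_sym.
rewrite (reindex_inj (h := fun z => - (1 + z * x))) /=; last first.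
  by move=> z z' /oppr_inj/addrI/(mulIf x_neq0).
rewrite [RHS]mulr_sumr; apply: eq_bigr => z _.
(* This [z] is the point [k = 0], where no [l] lies on the curve. *)
have [zx|zx_neq0] := eqVneq (1 + z * x) 0.
  by rewrite zx oppr0 !charF0 big1 => [|l _]; rewrite !(mul0r, mulr0).
have root_l l : (1 - (1 + z * x) + - (1 + z * x) * l * (- x / u) == 0) =
    (l == z * u / (1 + z * x)).
  have -> : 1 - (1 + z * x) + - (1 + z * x) * l * (- x / u) =
      (l - z * u / (1 + z * x)) * ((1 + z * x) * x / u).
    by field; rewrite u_neq0 zx_neq0.
  rewrite mulf_eq0 subr_eq0 orbC !mulf_eq0 invr_eq0.
  by rewrite (negbTE zx_neq0) (negbTE x_neq0) (negbTE u_neq0).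
rewrite (bigD1 (z * u / (1 + z * x))) //= [X in _ + X]big1 ?addr0; last first.
  move=> l l_neq.
  by rewrite root_l (negbTE l_neq) mulr0 mul0r.
rewrite root_l eqxx mulr1.
have -> : 1 + z * u / (1 + z * x) + - (1 + z * x) * (z * u / (1 + z * x)) * (- y / u) =
    (1 + z) * (1 + z * (x * y)) / (1 + z * x).
  rewrite /u; field; rewrite zx_neq0.
  by move: u_neq0; rewrite /u mulf_eq0 negb_or => /andP[-> ->].
have -> : - (1 + z * x) = -1 * (1 + z * x) by rewrite mulN1r.
rewrite !invMg !invgK [(C * A^-1)%g]mulchar_mulC; set phi := (A^-1 * C)%g.
have phi_s : phi (1 + z * x) = (A (1 + z * x))^-1 * C (1 + z * x).
  by rewrite charF_mul charF_inv.
move: phi phi_s => phi phi_s.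
rewrite !charFM !charFV phi_s charF_mul charF_inv; field.
by rewrite !charF_eq0 zx_neq0.
Qed.

End AppellSums.

(** * The reduction formula *)

Theorem theorem1p3 (R : realType) (F : finFieldType) (p r : nat)
    (p_prime : prime p) (p_odd : odd p) (r_gt0 : (0 < r)%N)
    (cardF : #|F| = (p ^ r)%N) (pcharF : p \in [pchar F])
    (zeta : R[i]) (zeta_prim : p.-primitive_root zeta)
    (A B C : mulchar F R[i])
    (B_neq1 : B <> 1%g) (A_neq_B : A <> B) (B_neq_C : B <> C) (C_neq_A : C <> A)
    (x y : F) (x_neq0 : x <> 0) (y_neq0 : y <> 0) (x_neq1 : x <> 1) (y_neq1 : y <> 1) :
  let g := gauss pcharF zeta in
  let u := (1 - x) * (1 - y) in
  appellF4 pcharF zeta A B C B (- x / u) (- y / u) =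
    A u * appellF1 pcharF zeta A (B^-1 * C)%g (A * C^-1)%g C x (x * y)
    - g B * g (A * B^-1)%g / ((p ^ r)%:R * g A) * charF B^-1%g y * B u.
Proof.
move/eqP: x_neq0 => x_neq0; move/eqP: y_neq0 => y_neq0.
move/eqP: x_neq1 => x_neq1; move/eqP: y_neq1 => y_neq1.
have A_neq_C : A <> C by move=> AC; apply: C_neq_A.
move=> g u; rewrite -cardF.
have u_neq0 : u != 0 by rewrite mulf_neq0 // subr_eq0 eq_sym.
rewrite (appellF4_sum pcharF zeta_prim) //; try by rewrite mulf_neq0 ?oppr_eq0 ?invr_eq0.
rewrite (appellF1_sum pcharF zeta_prim) ?mulf_neq0 //; last first.
- exact: mulgV_neq1.
- by rewrite mulchar_mulC => /mulgV_neq1; apply; apply/nesym.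
rewrite rational_curve_sum // -/u -/g; set S := \sum_z _.
rewrite charF_neg_div //.
(* One sign comes from [g B * g B^-1], the other from [k = - (1 + z * x)]. *)
have BN1 : B (-1) * B (-1) = 1 by rewrite -charFM mulrNN mulr1 charF1.
congr (_ - _); last by rewrite !mulrA.
set K := g _ / _.
have -> : K * B (-1) * (B (-1) * A u * S) = B (-1) * B (-1) * (A u * (K * S)) by ring.
by rewrite BN1 mul1r.
Qed.
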